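(* Let $X$ be a finite set with $|X|\ge 2$ and let $\mathbb{M}_X$ be the free monoid with basis $X$. Then every recursively enumerable language in the alphabet $X$, viewed as a subset of $\mathbb{M}_X$, is definable in $\mathbb{M}_X$ with parameters from $X$.
   Context: A subset $A\subseteq \mathbb{M}_X$ is definable with parameters from $X$ if there is a first-order formula $\phi(x)$ in the language of monoids, with constants for elements of $X$, such that $A=\{b\in\mathbb{M}_X : \mathbb{M}_X\models\phi(b)\}$. *)

(* Defs.v *)
From HB Require Import structures.
From mathcomp Require Import all_boot.

Set Implicit Arguments.
Unset Strict Implicit.
Unset Printing Implicit Defensive.

(* An alias of [seq X], so that the monoid structure does not become canonical
   on bare sequences. *)
Definition free_monoid (X : choiceType) := seq X.

HB.instance Definition _ (X : choiceType) := Choice.on (free_monoid X).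
HB.instance Definition _ (X : choiceType) :=
  isMonoid.Build (free_monoid X) (@catA X) (@cat0s X) (@cats0 X).

Definition basis (X : choiceType) (x : X) : free_monoid X := [:: x].

Inductive term (C : Type) : Type :=
| Var of nat
| Const of C
| One
| Mul of term C & term C.

Arguments Var {C} _.
Arguments One {C}.

Inductive formula (C : Type) : Type :=
| Equal of term C & term C
| Falsum
| Not of formula C
| And of formula C & formula C
| Or of formula C & formula C
| Implies of formula C & formula C
| Exists of nat & formula C
| Forall of nat & formula C.

Arguments Falsum {C}.

Fixpoint term_vars (C : Type) (t : term C) : seq nat :=
  match t with
  | Var n => [:: n]
  | Const _ | One => [::]
  | Mul t1 t2 => term_vars t1 ++ term_vars t2
  end.

Fixpoint free_vars (C : Type) (f : formula C) : seq nat :=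
  match f with
  | Equal t1 t2 => term_vars t1 ++ term_vars t2
  | Falsum => [::]
  | Not g => free_vars g
  | And g h | Or g h | Implies g h => free_vars g ++ free_vars h
  | Exists n g | Forall n g => [seq k <- free_vars g | k != n]
  end.

Section Semantics.

Variables (M : monoidType) (C : Type) (c : C -> M).

Definition update (e : nat -> M) (n : nat) (a : M) : nat -> M :=
  fun k => if k == n then a else e k.

Fixpoint eval (e : nat -> M) (t : term C) : M :=
  match t with
  | Var n => e n
  | Const x => c x
  | One => 1%g
  | Mul t1 t2 => (eval e t1 * eval e t2)%g
  end.

Fixpoint holds (e : nat -> M) (f : formula C) : Prop :=
  match f with
  | Equal t1 t2 => eval e t1 = eval e t2
  | Falsum => False
  | Not g => ~ holds e g
  | And g h => holds e g /\ holds e h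
  | Or g h => holds e g \/ holds e h
  | Implies g h => holds e g -> holds e h
  | Exists n g => exists a : M, holds (update e n a) g
  | Forall n g => forall a : M, holds (update e n a) g
  end.

(* [Var 0] is the only variable allowed to occur free in the defining formula,
   so the values of the other variables in the environment are irrelevant. *)
Definition definable (A : M -> Prop) : Prop :=
  exists f : formula C,
    {subset free_vars f <= [:: 0]} /\
    forall b : M, A b <-> holds (fun=> b) f.

End Semantics.

Inductive direction := MoveLeft | MoveRight.

(* Deterministic one-tape machines; [delta] is partial, and the machine halts
   where it is undefined. *)
Record turing_machine (X : finType) : Type := TuringMachine {
  state : finType;
  symbol : finType;
  input : X -> symbol;
  blank : symbol;
  input_inj : injective input;
  blank_not_input : forall x : X, input x != blank;
  start : state;
  accepting : pred state;
  delta : state -> symbol -> option (state * symbol * direction)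
}.

Section Computation.

Variables (X : finType) (T : turing_machine X).

(* The tape is infinite in both directions. In [(l, q, r)], [l] lists the cells
   to the left of the head, nearest first, and [r] lists the scanned cell and
   the cells to its right; every cell beyond either list is blank. *)
Definition config : Type := seq (symbol T) * state T * seq (symbol T).

Definition step (s : config) : option config :=
  let: (l, q, r) := s in
  match delta q (head (blank T) r) with
  | None => None
  | Some (q', b, MoveRight) => Some (b :: l, q', behead r)
  | Some (q', b, MoveLeft) =>
      Some (behead l, q', head (blank T) l :: b :: behead r)
  end.

Definition initial (w : seq X) : config := ([::], start T, map (@input X T) w).

Definition run (n : nat) (w : seq X) : option config :=
  iter n (obind step) (Some (initial w)).

Definition accepts (w : seq X) : Prop :=
  exists n l q r, run n w = Some (l, q, r) /\ accepting q.

End Computation.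

Definition recursively_enumerable (X : finType) (L : seq X -> Prop) : Prop :=
  exists T : turing_machine X, forall w : seq X, L w <-> accepts T w.

(* Main.v *)
(** Fix letters [a <> b]. A finite sequence of words is coded by the single word
    [B a w1 a B a w2 a B ...], where the separator [B] is a power of [b] that is
    a factor of no [wi]; powers of [b] are the words commuting with [b]. Since
    the separators in such a word can be located unambiguously, "[H] codes a
    sequence from [u] to [v] whose consecutive entries are [R]-related" is first
    order, so the reflexive transitive closure of a definable relation is
    definable. A configuration of the machine is the sequence of its state, its
    two half tapes as stacks of prefix-coded symbols, and the unread input, and
    one step of the machine only pushes and pops prefixes. *)

Require Import Defs.
From Corelib Require Import Setoid.
From mathcomp Require Import all_boot.

Set Implicit Arguments.
Unset Strict Implicit.
Unset Printing Implicit Defensive.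

(** * Expressible predicates *)

Section Expressible.

Variable X : finType.

Local Notation env := (nat -> free_monoid X).
Local Notation eval := (@eval (free_monoid X) X (@basis X)).
Local Notation holds := (@holds (free_monoid X) X (@basis X)).

(** A context supported below [n] leaves variable [n] fresh, so quantifying over [n] does not
    disturb the tuple already read. *)
Definition supported n (G : Type) (g : env -> G) : Prop :=
  forall e e' : env, (forall k, k < n -> e k = e' k) -> g e = g e'.

Definition finitely_supported (G : Type) (g : env -> G) : Prop :=
  exists n, supported n g.

(* A context [g] reads a tuple of type [G] off the environment; predicates and
   words over [G] can then be written with ordinary Rocq binders. *)
Definition expressible_word (G : Type) (g : env -> G) (t : G -> seq X) : Prop :=
  exists s, forall e, eval e s = t (g e).

Definition expressible (G : Type) (g : env -> G) (P : G -> Prop) : Prop :=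
  exists f, forall e, holds e f <-> P (g e).

Definition extend (G : Type) (g : env -> G) (n : nat) (e : env) : G * seq X :=
  (g e, e n).

Section Words.

Variables (G : Type) (g : env -> G).

Lemma expressible_cst (w : seq X) : expressible_word g (fun=> w).
Proof.
elim: w => [|x w [s Es]]; first by exists One.
by exists (Mul (Const x) s) => e; rewrite /= Es.
Qed.

Lemma expressible_cat (t u : G -> seq X) :
  expressible_word g t -> expressible_word g u ->
  expressible_word g (fun z => t z ++ u z).
Proof. by move=> [s Es] [r Er]; exists (Mul s r) => e; rewrite /= Es Er. Qed.

Lemma expressible_cons (x : X) (t : G -> seq X) :
  expressible_word g t -> expressible_word g (fun z => x :: t z).
Proof. by move=> [s Es]; exists (Mul (Const x) s) => e; rewrite /= Es. Qed.

Lemma expressible_last n : expressible_word (extend g n) (fun z => z.2).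
Proof. by exists (Var n). Qed.

Lemma expressible_weaken n (t : G -> seq X) :
  expressible_word g t -> expressible_word (extend g n) (fun z => t z.1).
Proof. by move=> [s Es]; exists s => e; rewrite Es. Qed.

Lemma supported_extend n : supported n g -> finitely_supported (extend g n).
Proof.
move=> gP; exists n.+1 => e e' ee'.
by rewrite /extend (gP e e') ?ee' // => k kn; apply: ee'; apply: ltnW.
Qed.

End Words.

Section Predicates.

Variables (G : Type) (g : env -> G).

Lemma expressible_iff (P Q : G -> Prop) :
  (forall z, P z <-> Q z) -> expressible g P -> expressible g Q.
Proof. by move=> PQ [f Ef]; exists f => e; rewrite Ef. Qed.

Lemma expressible_eq (t u : G -> seq X) :
  expressible_word g t -> expressible_word g u ->
  expressible g (fun z => t z = u z).
Proof. by move=> [s Es] [r Er]; exists (Equal s r) => e; rewrite /= Es Er. Qed.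

Lemma expressible_bool (b : bool) : expressible g (fun=> b).
Proof.
exists (if b then Equal One One else Falsum) => e.
by case: b; split.
Qed.

Lemma expressible_False : expressible g (fun=> False).
Proof. by exists Falsum. Qed.

Lemma expressible_True : expressible g (fun=> True).
Proof. by exists (Equal One One). Qed.

Lemma expressible_not (P : G -> Prop) :
  expressible g P -> expressible g (fun z => ~ P z).
Proof. by move=> [f Ef]; exists (Defs.Not f) => e; rewrite /= Ef. Qed.

Lemma expressible_and (P Q : G -> Prop) :
  expressible g P -> expressible g Q -> expressible g (fun z => P z /\ Q z).
Proof. by move=> [f Ef] [h Eh]; exists (Defs.And f h) => e; rewrite /= Ef Eh. Qed.

Lemma expressible_or (P Q : G -> Prop) :
  expressible g P -> expressible g Q -> expressible g (fun z => P z \/ Q z).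
Proof. by move=> [f Ef] [h Eh]; exists (Defs.Or f h) => e; rewrite /= Ef Eh. Qed.

Lemma expressible_imp (P Q : G -> Prop) :
  expressible g P -> expressible g Q -> expressible g (fun z => P z -> Q z).
Proof.
by move=> [f Ef] [h Eh]; exists (Defs.Implies f h) => e; rewrite /= Ef Eh.
Qed.

Lemma expressible_ex (P : G -> seq X -> Prop) :
  finitely_supported g ->
  (forall n, supported n g -> expressible (extend g n) (fun z => P z.1 z.2)) ->
  expressible g (fun z => exists x, P z x).
Proof.
move=> [n gn] /(_ n gn) [f Ef]; exists (Exists n f) => e /=.
have E x : g (update e n x) = g e.
  by apply: gn => k kn; rewrite /update ltn_eqF.
by split=> -[x Hx]; exists x; move: Hx; rewrite Ef /= E /update eqxx.
Qed.

Lemma expressible_all (P : G -> seq X -> Prop) :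
  finitely_supported g ->
  (forall n, supported n g -> expressible (extend g n) (fun z => P z.1 z.2)) ->
  expressible g (fun z => forall x, P z x).
Proof.
move=> [n gn] /(_ n gn) [f Ef]; exists (Forall n f) => e /=.
have E x : g (update e n x) = g e.
  by apply: gn => k kn; rewrite /update ltn_eqF.
by split=> Hx x; move: (Hx x); rewrite Ef /= E /update eqxx.
Qed.

(** States and symbols are not words: quantifying over a finite type becomes a finite disjunction of
    formulas. *)
Lemma expressible_finex (I : finType) (P : I -> G -> Prop) :
  (forall i, expressible g (P i)) -> expressible g (fun z => exists i, P i z).
Proof.
move=> HP.
suff H (s : seq I) : expressible g (fun z => exists2 i, i \in s & P i z).
  apply: expressible_iff (H (enum I)) => z.
  by split=> [[i _]|[i]] Pi; exists i; rewrite ?mem_enum.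
elim: s => [|i s IH].
  by apply: expressible_iff expressible_False => z; split=> // -[].
apply: expressible_iff (expressible_or (HP i) IH) => z; split.
- by case=> [Pi|[j js Pj]]; [exists i | exists j] => //;
    rewrite inE ?eqxx ?js ?orbT.
- by case=> j; rewrite inE => /predU1P[->|js] Pj; [left | right; exists j].
Qed.

End Predicates.

(** The formula may contain other free variables, but its truth depends only on the value of
    variable 0, so quantifying the others existentially changes nothing. *)
Lemma expressible_definable (A : seq X -> Prop) :
  expressible (fun e : env => e 0) A -> definable (@basis X) A.
Proof.
case=> f Ef.
pose close := foldr (@Exists X) f.
have closeP s e : all (predC1 0) s -> holds e (close s) <-> A (e 0).
  elim: s e => [|k s IH] e /=; first by rewrite Ef.
  case/andP=> k0 /IH{}IH; rewrite eq_sym in k0.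
  split=> [[x]|Ae]; first by rewrite IH /update (negPf k0).
  by exists [::]; rewrite IH /update (negPf k0).
have close_vars s k :
    k \in free_vars (close s) = (k \in free_vars f) && (k \notin s).
  elim: s => [|j s IH] /=; first by rewrite andbT.
  by rewrite mem_filter IH inE negb_or andbCA.
exists (close [seq k <- free_vars f | k != 0]); split=> [k|w].
  rewrite close_vars mem_filter inE => /andP[-> /=].
  by rewrite andbT negbK.
by rewrite closeP ?filter_all.
Qed.

(** Allowing arbitrary contexts and word terms lets the relation be used beneath quantifiers. *)
Definition expressible_rel (R : seq X -> seq X -> Prop) : Prop :=
  forall (G : Type) (g : env -> G) t u, finitely_supported g ->
  expressible_word g t -> expressible_word g u ->
  expressible g (fun z => R (t z) (u z)).

End Expressible.

Lemma expressible_infix (X : finType) :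
  expressible_rel (fun u v : seq X => infix u v).
Proof.
move=> G g t u gP tP uP.
apply: (@expressible_iff X G g (fun z => exists p q, u z = p ++ t z ++ q)).
  by move=> z; split=> [[p [q E]]|/infixP[p [q E]]];
    [apply/infixP|]; exists p, q.
apply: expressible_ex => // n gn.
apply: expressible_ex => [|m _]; first exact: supported_extend.
have weaken w : expressible_word g w ->
    expressible_word (extend (extend g n) m) (fun z => w z.1.1).
  by move=> /(expressible_weaken n) /(expressible_weaken m).
apply: expressible_eq; first exact: weaken.
apply: expressible_cat.
  exact: (expressible_weaken m (expressible_last g n)).
by apply: expressible_cat; [exact: weaken|exact: expressible_last].
Qed.

(* When [t z] depends only on [z.1], it is convertible to [t (z.1, [::])], which
   has the shape expected by [expressible_weaken]. *)
Ltac express_word :=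
  first
  [ eassumption
  | apply: expressible_cst
  | apply: expressible_last
  | apply: expressible_cat; express_word
  | apply: expressible_cons; express_word
  | lazymatch goal with
    | |- expressible_word (extend _ _) ?t =>
        apply: (@expressible_weaken _ _ _ _ (fun z => t (z, [::])));
        cbv beta; cbn [fst snd]; express_word
    end ].

Ltac express_support :=
  first [ assumption | apply: supported_extend; eassumption ].

Ltac express :=
  lazymatch goal with
  | |- expressible_word _ _ => express_word
  | |- finitely_supported _ => express_support
  | |- expressible _ _ =>
    cbv beta;
    first
    [ apply: expressible_infix; express
    | apply: expressible_eq; express
    | apply: expressible_not; express
    | apply: expressible_and; express
    | apply: expressible_or; express
    | apply: expressible_ex; [express | move=> ? ?; express]
    | apply: expressible_all; [express | move=> ? ?; express]
    | apply: expressible_finex => ?; express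
    | apply: expressible_imp; express
    | apply: expressible_bool
    | apply: expressible_False
    | apply: expressible_True
    | idtac ]
  | _ => idtac
  end.

(** * Coding finite sequences of words *)

(** Levi's lemma for free monoids. *)
Lemma cat_eq_cat (T : Type) (x y z t : seq T) :
  x ++ y = z ++ t ->
  (exists d, x = z ++ d /\ t = d ++ y) \/ (exists d, z = x ++ d /\ y = d ++ t).
Proof.
elim: x z => [|c x IH] [|d z] /= E.
- by left; exists [::].
- by right; exists (d :: z).
- by left; exists (c :: x); split.
case: E => <- /IH[[e [-> ->]]|[e [-> ->]]]; [left|right]; by exists e.
Qed.

Section Coding.

Variables (X : finType) (a b : X).
Hypothesis ab : a != b.

Implicit Types (B H d p q u v w x y t : seq X) (ws xs ys : seq (seq X)).

(** The letters [a] around an entry keep its own powers of [b] from merging with the separators. *)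
Fixpoint code B ws : seq X :=
  if ws is w :: ws' then B ++ a :: w ++ a :: code B ws' else B.

Fixpoint separates B ws : Prop :=
  if ws is w :: ws' then ~ infix B w /\ separates B ws' else True.

Lemma power_commute B : B ++ [:: b] = b :: B <-> exists n, B = nseq n b.
Proof.
split=> [|[n ->]]; last first.
  by elim: n => //= n ->.
elim: B => [|c B IH] /=; first by exists 0.
by case=> -> /IH[n ->]; exists n.+1.
Qed.

Lemma code_head B ws : exists t, code B ws = B ++ t.
Proof.
by case: ws => [|w ws]; [exists [::]; rewrite /= cats0|eexists].
Qed.

(** If [w] is at least as long as the power of [b], that power is a prefix of [w]; otherwise the
    letter at position [size w] is [b] on one side and [a] on the other. *)
Lemma separator_not_split n w t t' :
  ~ infix (nseq n b) w -> nseq n b ++ t' <> w ++ a :: t.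
Proof.
move=> nBw E; have [nw|wn] := leqP n (size w).
  apply: nBw; suff -> : nseq n b = take n w by apply: infix_take.
  have := congr1 (take n) E.
  by rewrite take_size_cat ?size_nseq // takel_cat.
move/(congr1 (fun s => nth a s (size w))): E.
rewrite !nth_cat size_nseq wn ltnn subnn nth_nseq wn /= => ba.
by move: ab; rewrite ba eqxx.
Qed.

(** Were one of [x], [y] longer, the separator after the shorter would either fit inside the longer
    or run into the [a] that ends it. *)
Lemma separator_cat_inj n x y t t' :
  let B := nseq n b in ~ infix B x -> ~ infix B y ->
  x ++ a :: B ++ t = y ++ a :: B ++ t' -> x = y /\ t = t'.
Proof.
move=> B Bx By E.
have [[[|c d] [ex et]]|[[|c d] [ex et]]] := cat_eq_cat E.
- case: et => /eqP; rewrite eqseq_cat // eqxx /= => /eqP ->.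
  by rewrite ex cats0.
- case: et => ac et; case: (@separator_not_split n d (B ++ t) t') => //.
  by move=> Bd; apply: Bx; rewrite ex -cat_rcons infix_catl.
- case: et => /eqP; rewrite eqseq_cat // eqxx /= => /eqP ->.
  by rewrite ex cats0.
- case: et => ac et; case: (@separator_not_split n d (B ++ t') t) => //.
  by move=> Bd; apply: By; rewrite ex -cat_rcons infix_catl.
Qed.

Lemma code_occurrence n ws p x q :
  let B := nseq n b in separates B ws -> ~ infix B x ->
  code B ws = p ++ B ++ a :: x ++ a :: B ++ q ->
  exists ws1 ws2, ws = ws1 ++ x :: ws2 /\ code B ws2 = B ++ q.
Proof.
move=> B + Bx; elim: ws p => [|w ws IH] p /=.
  move=> _ /(congr1 size); rewrite size_cat [size (B ++ _)]size_cat /= => E.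
  suff : size B < size B by rewrite ltnn.
  rewrite {2}E.
  by rewrite addnCA -[X in X < _]addn0 ltn_add2l addnS.
case=> Bw Bws E.
(* [B] is nonempty, since the empty word is a factor of [x]. *)
have B0 t t' : B ++ t <> a :: t'.
  apply: (@separator_not_split n [::] t' t) => B0.
  by apply: Bx; apply: infix_trans B0 (infix0s _).
(* An occurrence starting within the leading [B] starts at its beginning: a proper suffix of [B] is
   too short to contain [B] and is followed by [a]. *)
have [[d [Bpd dE]]|[d [pBd dE]]] := cat_eq_cat E.
  have [Bd|Bd] := boolP (infix B d); last first.
    by have /negP/separator_not_split := Bd; move/(_ _ _ dE).
  have p0 : p = [::].
    apply: size0nil; apply/eqP; rewrite -leqn0 -(leq_add2r (size d)) add0n.
    by rewrite -size_cat -Bpd (size_infix Bd).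
  move: Bpd dE; rewrite p0 /= => <- /eqP.
  rewrite eqseq_cat // eqxx /= => /eqP[].
  have [r Er] := code_head B ws; rewrite Er => /separator_cat_inj.
  case=> // -> ->; exists [::], ws; split=> //.
case: d pBd dE => [|c d] pBd; first by move/esym/B0.
case=> _ dE.
(* The occurrence starts after [B a]. Starting no later than the end of [w] would make [B] a factor
   of [w], so it lies in the code of the tail. *)
have [[e [we eE]]|[e [de eE]]] := cat_eq_cat dE.
  case: (@separator_not_split n e (code B ws) (a :: x ++ a :: B ++ q)) => //.
  by move=> Be; apply: Bw; rewrite we infix_catl.
case: e de eE => [|c' e] de; first by move/esym/B0.
case=> _ /(IH _ Bws)[ws1 [ws2 [-> E2]]].
by exists (w :: ws1), ws2.
Qed.

Lemma code_inj n xs ys :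
  let B := nseq n b in separates B xs -> separates B ys ->
  code B xs = code B ys -> xs = ys.
Proof.
move=> B; elim: xs ys => [|x xs IH] [|y ys] //=.
- by move=> _ _ /(congr1 size)/eqP; rewrite size_cat -[X in X == _]addn0 eqn_add2l.
- by move=> _ _ /(congr1 size)/eqP; rewrite size_cat -[X in _ == X]addn0 eqn_add2l.
move=> [Bx Bxs] [By Bys] /eqP.
rewrite eqseq_cat // eqxx /= => /eqP[].
have [r Er] := code_head B xs; have [r' Er'] := code_head B ys.
rewrite Er Er' => /separator_cat_inj[] // -> rr'.
by congr (_ :: _); apply: IH => //; rewrite Er Er' rr'.
Qed.

Definition codes u ws : Prop :=
  exists B, B ++ [:: b] = b :: B /\ separates B ws /\ u = code B ws.

Lemma nseq_cat_inj m n t t' :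
  nseq m b ++ a :: t = nseq n b ++ a :: t' -> m = n /\ t = t'.
Proof.
have bF : (b == a) = false by rewrite eq_sym (negPf ab).
elim: m n => [|m IH] [|n] //=.
- by case.
- by case=> /eqP; rewrite (negPf ab).
- by case=> /eqP; rewrite bF.
by case=> /IH[-> ->].
Qed.

(** The code of a nonempty sequence begins with its separator followed by [a], so both codings use
    the same separator and [code_inj] applies. *)
Lemma codes_inj u x xs y ys :
  codes u (x :: xs) -> codes u (y :: ys) -> x :: xs = y :: ys.
Proof.
move=> [B [/power_commute[n ->] [Bx ->]]] [B' [/power_commute[m ->] [By E]]].
have [nm _] := nseq_cat_inj E.
by move: By E; rewrite -nm => By /code_inj; apply.
Qed.

Lemma separator_exists ws : exists n, separates (nseq n b) ws.
Proof.
(* Asking for all larger exponents too lets one maximum serve both head and tail. *)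
suff [n Hn] : exists n, forall m, n <= m -> separates (nseq m b) ws.
  by exists n; apply: Hn.
elim: ws => [|w ws [n Hn]]; first by exists 0.
exists (maxn n (size w).+1) => m; rewrite geq_max => /andP[nm wm] /=.
split; last exact: Hn.
by move/size_infix; rewrite size_nseq leqNgt wm.
Qed.

Lemma codes_exists ws : exists u, codes u ws.
Proof.
have [n Hn] := separator_exists ws; exists (code (nseq n b) ws), (nseq n b).
by split=> //; apply/power_commute; exists n.
Qed.

(** * Reflexive transitive closure through coded histories *)

Fixpoint chain (R : seq X -> seq X -> Prop) x ws : Prop :=
  if ws is y :: ws' then R x y /\ chain R y ws' else True.

Definition reachable R x y : Prop := exists ws, chain R x ws /\ last x ws = y.

Lemma chain_cat R x ws1 y z ws2 :
  chain R x (ws1 ++ y :: z :: ws2) -> R y z.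
Proof.
by elim: ws1 x => [|w ws1 IH] x /= []; [move=> _ [] | move=> _ /IH].
Qed.

(* From right to left no parsing is needed: each entry read in [H] is followed by
   an [R]-successor or is [v], and the unread part of [H] shrinks. *)
Lemma reachable_history R u v :
  reachable R u v <->
  exists B H, B ++ [:: b] = b :: B /\ ~ infix B u /\
    (exists q, H = B ++ a :: u ++ a :: B ++ q) /\
    forall p x q, H = p ++ B ++ a :: x ++ a :: B ++ q -> ~ infix B x ->
      x = v \/ exists y q', ~ infix B y /\ R x y /\ q = a :: y ++ a :: B ++ q'.
Proof.
split.
  move=> [ws [uws <-]].
  have [n] := separator_exists (u :: ws); set B := nseq n b => Bws.
  exists B, (code B (u :: ws)); split; first by apply/power_commute; exists n.
  split; first by case: Bws.
  split; first by have [q Eq] := code_head B ws; exists q; rewrite -Eq.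
  move=> p x q /code_occurrence - /(_ Bws) occ /occ[ws1 [[|y ws2] [E E2]]].
    by left; rewrite -[RHS]/(last u (u :: ws)) E last_cat.
  right; move: E2 => /= /eqP.
  rewrite eqseq_cat // eqxx /= => /eqP <-.
  have [q' Eq'] := code_head B ws2; exists y, q'; rewrite Eq'; split.
    move: Bws; rewrite E; elim: (ws1) => /=; first by move=> [_ []].
    by move=> w ws' IH [_ /IH].
  split=> //.
  case: ws1 E => [|w ws1] /= [ux E]; first by move: uws; rewrite -ux E => -[].
  by move: uws; rewrite E => /chain_cat.
move=> [B [H [_ [Bu [[q Hq] next]]]]].
have reach k p x q1 : size q1 < k -> H = p ++ B ++ a :: x ++ a :: B ++ q1 ->
    ~ infix B x -> reachable R x v.
  elim: k p x q1 => // k IH p x q1; rewrite ltnS => q1k E Bx.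
  have [->|[y [q2 [By [Rxy E1]]]]] := next _ _ _ E Bx; first by exists [::].
  (* The separator closing [x] also opens [y], so the new prefix stops just before it. *)
  have [||//|ws [yws wsv]] := IH (p ++ B ++ a :: x ++ [:: a]) y q2.
  - apply: leq_trans q1k; rewrite E1 /= size_cat /= size_cat.
    by rewrite addnS !ltnS addnA leqW // leq_addl.
  - by rewrite E E1 /= -!catA /= -!catA.
  by exists (y :: ws).
exact: (reach (size q).+1 [::] u q).
Qed.

End Coding.

Lemma expressible_reachable (X : finType) (a b : X) (R : seq X -> seq X -> Prop) :
  a != b -> expressible_rel R -> expressible_rel (reachable R).
Proof.
move=> ab HR G g t u gP tP uP.
apply: expressible_iff => [z|].
  by apply: iff_sym; apply: (reachable_history ab).
by express; apply: HR; express.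
Qed.

(** * Coding configurations *)

Section Simulation.

Variables (X : finType) (a b : X).
Hypothesis ab : a != b.
Variable T : turing_machine X.

(** The words [b^i a] form a prefix code, so a concatenation can be peeled off from the left. *)
Definition index_word (I : finType) (i : I) : seq X :=
  rcons (nseq (enum_rank i) b) a.

Fixpoint stack_word (l : seq (symbol T)) : seq X :=
  if l is c :: l' then index_word c ++ stack_word l' else [::].

Lemma index_word_cat_inj (I : finType) (i j : I) t t' :
  index_word i ++ t = index_word j ++ t' -> i = j /\ t = t'.
Proof.
rewrite !cat_rcons => /(nseq_cat_inj ab)[ij ->].
by split=> //; apply/enum_rank_inj/val_inj.
Qed.

Lemma index_word_inj (I : finType) : injective (@index_word I).
Proof.
move=> i j ij.
by have [] := @index_word_cat_inj I i j [::] [::] (congr1 (cat^~ [::]) ij).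
Qed.

(** The second alternative is the blank tape beyond the list: popping the empty stack yields a blank
    and leaves it empty. *)
Definition pop (s : symbol T) (l l' : seq X) : Prop :=
  l = index_word s ++ l' \/ l = [::] /\ l' = [::] /\ s == blank T.

(* [w] is the part of the input that the head has not reached yet. It is kept in
   the alphabet [X], and only when [r] is exhausted is a letter of [w] read. *)
Definition scan (s : symbol T) (r w r' w' : seq X) : Prop :=
  r = index_word s ++ r' /\ w' = w \/
  r = [::] /\ r' = [::] /\
    ((exists x, s == input T x /\ w = x :: w') \/
     w = [::] /\ w' = [::] /\ s == blank T).

Definition word_step (q l r w q' l' r' w' : seq X) : Prop :=
  exists (p : state T) (s : symbol T) r1 w1, q = index_word p /\
    scan s r w r1 w1 /\
    match delta p s with
    | None => False
    | Some (p', c, MoveRight) =>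
        q' = index_word p' /\ l' = index_word c ++ l /\ r' = r1 /\ w' = w1
    | Some (p', c, MoveLeft) => exists d, q' = index_word p' /\ pop d l l' /\
        r' = index_word d ++ index_word c ++ r1 /\ w' = w1
    end.

(** Packing the four components into one word turns a step into a binary relation on words, to which
    [reachable] applies. *)
Definition code_step u v : Prop :=
  exists q l r w q' l' r' w', codes a b u [:: q; l; r; w] /\
    codes a b v [:: q'; l'; r'; w'] /\ word_step q l r w q' l' r' w'.

Lemma index_word_neq_nil (I : finType) (i : I) t : index_word i ++ t <> [::].
Proof. by rewrite cat_rcons; case: (nat_of_ord _). Qed.

Lemma popP s l l' :
  pop s (stack_word l) l' <-> s = head (blank T) l /\ l' = stack_word (behead l).
Proof.
case: l => [|c l] /=; split.
- by case=> [/esym/index_word_neq_nil|[_ [-> /eqP ->]]].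
- by case=> -> ->; right.
- by case=> [/index_word_cat_inj[-> ->]|[/index_word_neq_nil]].
- by case=> -> ->; left.
Qed.

Lemma scanP s r w r' w' :
  scan s (stack_word r) w r' w' <->
  [/\ s = head (blank T) (r ++ map (@input X T) w), r' = stack_word (behead r) &
      w' = if r is [::] then behead w else w].
Proof.
case: r => [|c r] /=; split.
- case=> [[/esym/index_word_neq_nil]|] //.
  by case=> _ [-> [[x [/eqP -> ->]]|[-> [-> /eqP ->]]]].
- case=> -> -> ->; right; do 2!split=> //.
  by case: w => [|x w]; [right | left; exists x].
- by case=> [[/index_word_cat_inj[-> ->] ->]|[/index_word_neq_nil]].
- by case=> -> -> ->; left.
Qed.

(* [u] represents the configuration whose right half is [r] followed by the
   unread input [w]. *)
Definition represents (u : seq X) (c : config T) : Prop :=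
  exists q l r w, codes a b u
      [:: index_word q; stack_word l; stack_word r; w] /\
    c = (l, q, r ++ map (@input X T) w).

Lemma behead_scan r w :
  behead (r ++ map (@input X T) w) =
  behead r ++ map (@input X T) (if r is [::] then behead w else w).
Proof. by case: r w => [|c r] [|x w]. Qed.

(** * Correctness of the simulation *)

Lemma code_step_sound u c v : represents u c -> code_step u v ->
  exists2 c', step c = Some c' & represents v c'.
Proof.
move=> [q [l [r [w [uc ->]]]]].
move=> [q1 [l1 [r1 [w1 [q' [l' [r' [w' [uc1 [vc]]]]]]]]]].
case: (codes_inj ab uc uc1) => <- <- <- <- [p [s [r2 [w2 [Eq [/scanP[-> -> ->]]]]]]].
rewrite -(index_word_inj Eq).
rewrite /= behead_scan.
case: (delta q _) => [[[p' s'] []]|] //.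
- case=> d [Eq' [/popP[-> El] [Er Ew]]].
  eexists; first by [].
  exists p', (behead l), (head (blank T) l :: s' :: behead r), w'.
  by split; [rewrite /= -Eq' -El -Er | rewrite Ew].
- case=> Eq' [El [Er Ew]].
  eexists; first by [].
  exists p', (s' :: l), (behead r), w'.
  by split; [rewrite /= -Eq' -El -Er | rewrite Ew].
Qed.

Lemma code_step_complete u c c' : represents u c -> step c = Some c' ->
  exists2 v, code_step u v & represents v c'.
Proof.
move=> [q [l [r [w [uc ->]]]]] /=.
have scan_r := (scanP _ r w _ _).2 (And3 erefl erefl erefl).
rewrite behead_scan; set w1 := (if r is [::] then _ else _) in scan_r *.
case E: (delta q _) => [[[p' d] []]|] // [<-].
- have [v vc] := codes_exists a b [:: index_word p'; stack_word (behead l);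
    stack_word (head (blank T) l :: d :: behead r); w1].
  exists v; last by eexists _, _, _, _; split; [exact: vc|].
  do 8!eexists; split; [exact: uc|split; [exact: vc|]].
  do 4!eexists; split; [by []|split; [exact: scan_r|]].
  by rewrite E; exists (head (blank T) l); split=> //; split; first exact/popP.
- have [v vc] := codes_exists a b [:: index_word p'; stack_word (d :: l);
    stack_word (behead r); w1].
  exists v; last by eexists _, _, _, _; split; [exact: vc|].
  do 8!eexists; split; [exact: uc|split; [exact: vc|]].
  do 4!eexists; split; [by []|split; [exact: scan_r|]].
  by rewrite E.
Qed.

Lemma reachable_sound u c v : represents u c -> reachable code_step u v ->
  exists n c', iter n (obind (@step X T)) (Some c) = Some c' /\ represents v c'.
Proof.
move=> uc [ws [+ <-]]; elim: ws u c uc => [|w ws IH] u c uc /=.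
  by exists 0, c.
case=> /(code_step_sound uc)[c1 cc1 wc1] /(IH _ _ wc1)[n [c' [E vc']]].
by exists n.+1, c'; rewrite iterSr /= cc1.
Qed.

Lemma iter_step_complete u c n c' : represents u c ->
  iter n (obind (@step X T)) (Some c) = Some c' ->
  exists2 v, reachable code_step u v & represents v c'.
Proof.
elim: n u c => [|n IH] u c uc; first by case=> <-; exists u => //; exists [::].
rewrite iterSr /=; case cc1: (step c) => [c1|]; last first.
  (* A halted run stays at [None]. *)
  by rewrite (_ : iter n _ None = None) //; elim: n {IH} => //= n ->.
have [v uv vc1] := code_step_complete uc cc1.
move=> /(IH _ _ vc1)[v' [ws [vws <-]] vc']; exists (last v ws) => //.
by exists (v :: ws).
Qed.

(** Initially both stacks are empty and all of [w] is unread, so [w] enters the code verbatim, with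
    no letter-by-letter translation to be expressed. *)
Lemma accepts_code w :
  accepts T w <->
  exists u v q l r w', codes a b u [:: index_word (start T); [::]; [::]; w] /\
    reachable code_step u v /\ codes a b v [:: q; l; r; w'] /\
    exists p : state T, accepting p /\ q = index_word p.
Proof.
split.
  move=> [n [l [q [r [Hrun acc]]]]].
  have [u uc] := codes_exists a b [:: index_word (start T); [::]; [::]; w].
  have uw : represents u (initial T w) by exists (start T), [::], [::], w.
  have [v uv [q' [l' [r' [w' [vc [_ Eq _]]]]]]] := iter_step_complete uw Hrun.
  exists u, v; do 4!eexists; do 3!split=> //; first exact: vc.
  by exists q; rewrite -Eq.
move=> [u [v [q [l [r [w' [uc [uv [vc [p [acc Eq]]]]]]]]]]].
have uw : represents u (initial T w) by exists (start T), [::], [::], w.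
have [n [c [Hrun [q' [l' [r' [w1 [vc' Ec]]]]]]]] := reachable_sound uw uv.
have := codes_inj ab vc vc'; rewrite Eq => -[Epq' _ _ _].
exists n, l', q', (r' ++ map (@input X T) w1).
by rewrite -Ec -(index_word_inj Epq').
Qed.

Lemma expressible_code_step : expressible_rel code_step.
Proof.
move=> G g u v gP uP vP; rewrite /code_step /word_step /pop /scan.
express.
(* The state and symbol are now fixed, so the transition table is consulted outside the formula. *)
by lazymatch goal with
  |- context [delta ?p ?s] => case: (delta p s) => [[[? ?] []]|]
end; express.
Qed.

End Simulation.

Theorem theorem5 (X : finType) (hX : 2 <= #|X|)
    (L : free_monoid X -> Prop) (hL : recursively_enumerable L) :
  definable (@basis X) L.
Proof.
have /card_gt1P[a [b [_ _ ab]]] := hX.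
have [T LT] := hL; apply: expressible_definable.
apply: expressible_iff => [w|].
  by apply: iff_sym; apply: iff_trans (LT w) (accepts_code ab T w).
have g0 : finitely_supported (fun e : nat -> free_monoid X => e 0).
  by exists 1 => e e'; apply.
have w0 : expressible_word (fun e : nat -> free_monoid X => e 0) id.
  by exists (Var 0).
by express; apply: (expressible_reachable ab (@expressible_code_step X a b T)); express.
Qed.
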